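(* There is a dense $G_\delta$ set $\mathcal O$ in $L^1[0,1]$ (real-valued functions, $L^1$-norm topology) such that if $G\in\mathcal O$, then for Lebesgue-a.e. $x\in[0,1]$, $E(G|\mathcal D_n)(x)>G(x)$ for infinitely many $n\ge1$, and $E(G|\mathcal D_n)(x)<G(x)$ for infinitely many (other) $n\ge1$.
   Context: $[0,1]$ carries Lebesgue measure. $\mathcal D_n$ is the dyadic $\sigma$-algebra on $[0,1]$ whose atoms are (up to null sets) the intervals $[\frac{j}{2^n},\frac{j+1}{2^n}]$, $j=0,\dots,2^n-1$, and $E(G|\mathcal D_n)$ is the conditional expectation, i.e. on each such interval it equals the average of $G$ over that interval. *)

(* Defs.v *)
From HB Require Import structures.
From mathcomp Require Import all_boot all_order all_algebra.
From mathcomp Require Import all_classical all_reals all_analysis.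
From mathcomp Require Import measurable_realfun borel_hierarchy.

Set Implicit Arguments.
Unset Strict Implicit.
Unset Printing Implicit Defensive.

Import Order.TTheory GRing.Theory Num.Theory.
Import numFieldNormedType.Exports.

Local Open Scope classical_set_scope.
Local Open Scope ring_scope.

(* [LspaceType1 mu], the quotient of the mu-integrable functions by mu-a.e.
   equality, carries no topology in the library: this alias is equipped with
   the distance of the L^1 norm. *)
Definition L1space d (T : measurableType d) (R : realType)
  (mu : {measure set T -> \bar R}) : Type := LspaceType1 mu.

Section L1space_metric.
Context d (T : measurableType d) (R : realType).
Variable mu : {measure set T -> \bar R}.
Implicit Types f g h : L1space mu.

Local Notation "f \B g" := ((f : T -> R) \- (g : T -> R))%R (at level 50).

Definition L1dist f g : R := fine ('N[mu]_1 [EFin \o (f \B g)])%E.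

Let mf f : measurable_fun [set: T] (f : T -> R).
Proof. by case: f => f ?; exact: (measurable_funPT (repr f)). Qed.

Let mB f g : measurable_fun [set: T] (f \B g).
Proof. exact: (measurable_funB (mf f) (mf g)). Qed.

Let finN f : ('N[mu]_1 [EFin \o (f : T -> R)] < +oo)%E.
Proof. exact: Lebesgue_finite. Qed.

Let finB f g : ('N[mu]_1 [EFin \o (f \B g)] < +oo)%E.
Proof.
have := @eminkowski _ _ _ mu (f : T -> R) (\- (g : T -> R))%R 1%E (mf f).
move=> /(_ (measurableT_comp (@oppr_measurable R setT) (mf g)) (lexx _)).
move=> /le_lt_trans; apply.
rewrite (_ : EFin \o (\- (g : T -> R))%R = \- (EFin \o (g : T -> R)))%E// oppe_Lnorm.
by rewrite lte_add_pinfty.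
Qed.

Let distE f g : (L1dist f g)%:E = 'N[mu]_1 [EFin \o (f \B g)]%E.
Proof. by rewrite fineK// ge0_fin_numE ?Lnorm_ge0. Qed.

Let distxx f : L1dist f f = 0.
Proof.
rewrite /L1dist (_ : EFin \o _ = cst 0%E) ?Lnorm0//.
by apply/funext => x /=; rewrite subrr.
Qed.

Let dist_sym f g : L1dist f g = L1dist g f.
Proof.
rewrite /L1dist (_ : EFin \o _ = \- (EFin \o (g \B f)))%E ?oppe_Lnorm//.
by apply/funext => x /=; rewrite opprB.
Qed.

Let dist_triangle g f h : L1dist f h <= L1dist f g + L1dist g h.
Proof.
rewrite -lee_fin EFinD !distE.
rewrite (_ : f \B h = (f \B g) \+ (g \B h)).
  by apply: (eminkowski mu (mB f g) (mB g h)).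
by apply/funext => x /=; rewrite addrA subrK.
Qed.

Let dist_eq0 f g : L1dist f g = 0 -> f = g.
Proof.
move=> fg0.
have {fg0} /Lnorm_eq0_eq0 : 'N[mu]_1 [EFin \o (f \B g)]%E = 0%E.
  by rewrite -distE fg0.
have mfg := (measurable_EFinP _ _).2 (mB f g).
move=> /(_ mfg lte01) fg.
have {}fg : (f : T -> R) = g %[ae mu].
  apply: filterS fg => x /= fgx _; have [fgx0] := fgx I.
  by apply/eqP; rewrite -subr_eq0; apply/eqP.
case: f g fg{mfg} => [f [[cf]]] [g [[cg]]] /= fg.
have fgE : f = g.
  rewrite -[f]reprK -[g]reprK; apply/eqquotP; exact/asboolP.
by subst g; rewrite (Prop_irrelevance cf cg).
Qed.

HB.instance Definition _ := gen_eqMixin (L1space mu).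
HB.instance Definition _ := gen_choiceMixin (L1space mu).
HB.instance Definition _ := @isMetric.Build R (L1space mu) L1dist
  distxx dist_eq0 dist_sym dist_triangle.

End L1space_metric.

Section dyadic.
Context (R : realType).

Definition lebesgue01 : {measure set (measurableTypeR R) -> \bar R} :=
  mrestr lebesgue_measure (measurable_itv `[0%R, 1%R]).

(* Half-open, so that the atoms are disjoint; they cover [0, 1] up to the
   null set {1}. *)
Definition dyadic_itv (n j : nat) : set R :=
  `[j%:R / 2 ^+ n, j.+1%:R / 2 ^+ n[.

Definition dyadic_average (n j : nat) (g : R -> R) : R :=
  (\int[lebesgue01]_(y in dyadic_itv n j) g y)
  / fine (lebesgue01 (dyadic_itv n j)).

(* The version of the conditional expectation given the n-th dyadic
   sigma-algebra that is equal on each atom to the average over that atom. *)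
Definition dyadic_condexp (n : nat) (g : R -> R) (x : R) : R :=
  \sum_(j < 2 ^ n) dyadic_average n j g * \1_(dyadic_itv n j) x.

End dyadic.
Arguments lebesgue01 {R}.

(* Main.v *)
Require Import Defs.
From HB Require Import structures.
From mathcomp Require Import all_boot all_order all_algebra.
From mathcomp Require Import all_classical all_reals all_analysis.
From mathcomp Require Import measurable_realfun borel_hierarchy.
From mathcomp Require Import ring lra.

Set Implicit Arguments.
Unset Strict Implicit.
Unset Printing Implicit Defensive.

Import Order.TTheory GRing.Theory Num.Theory.
Import numFieldNormedType.Exports.

Local Open Scope classical_set_scope.
Local Open Scope ring_scope.

(** The set of all functions with the required a.e. oscillation is itself a
    dense G_delta. It is a G_delta because, for each sign s = 1, -1 and each k,
    the condition that s (E(G|D_n) - G) < d for all n in [k, M] only on a set of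
    measure less than 1/(k+1), for some M and some margin d > 0, is open in L^1:
    E(.|D_n) is Lipschitz from L^1 to the sup norm, and Markov's inequality
    controls the change of G. It is dense, without any appeal to Baire's
    theorem, because it contains every h(x) = (D_m-measurable step) + t x with
    t > 0: for n >= m the sign of E(h|D_n)(x) - h(x) is that of
    (midpoint of the D_n-atom of x) - x, which is given by the (n+1)-st binary
    digit of x. *)

(** * Binary digits *)

(** For the fractional parts of $2^n x$ this says that both binary digits recur beyond every
    place. *)
Lemma doubling_map_oscillates (R : realType) (u : R ^nat) :
    (forall n, 0 < u n < 1) ->
    (forall n, u n.+1 = if u n < 1 / 2 then 2 * u n else 2 * u n - 1) ->
  forall N, (exists2 n, (N <= n)%N & u n < 1 / 2) /\
            (exists2 n, (N <= n)%N & 1 / 2 < u n).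
Proof.
move=> u01 uS N.
(* On one side of [1/2] the map doubles [u], on the other it doubles [1 - u], so
   the orbit can stay on neither side forever. *)
have unbounded (v : R ^nat) : 0 < v N -> (forall n, v n < 1) ->
    exists2 n, (N <= n)%N & v n.+1 != 2 * v n.
  move=> v0 v1; apply/not_exists2P => dbl.
  have vE k : v (N + k)%N = 2 ^+ k * v N.
    elim: k => [|k IH]; first by rewrite addn0 expr0 mul1r.
    have [/(_ (leq_addr _ _))//|/negP/negPn/eqP vS] := dbl (N + k)%N.
    by rewrite addnS vS IH exprS mulrA.
  have [k _ /(_ _ (leqnn k)) /= Hk] := near_infty_natSinv_expn_lt (PosNum v0).
  have := v1 (N + k)%N; rewrite vE ltNge => /negP; apply.
  by rewrite -ler_pdivrMl ?exprn_gt0// mulr1 -div1r ltW.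
(* The value $1/2$ would be sent to $0$, which the strict bounds exclude; hence a failure to double
   forces [u n] strictly above $1/2$. *)
have u_neq n : u n != 1 / 2.
  apply: contraTneq (u01 n.+1) => un; rewrite uS un ltxx; lra.
split.
- have [||n Nn dbl] := unbounded (fun n => 1 - u n).
  + by have := u01 N; lra.
  + by move=> n; have := u01 n; lra.
  + exists n => //; move: dbl; rewrite uS; case: ltP => // ? /eqP[]; lra.
- have [||n Nn dbl] := unbounded u.
  + by have := u01 N; lra.
  + by move=> n; have := u01 n; lra.
  + exists n => //; move: dbl; rewrite uS; have := u_neq n.
    by case: ltgtP => // ? _ /eqP[].
Qed.

Section dyadic_digits.
Context (R : realType).
Implicit Types x : R.

Definition dyadic_index n x : nat := Num.truncn (2 ^+ n * x).
(** The relative position of [x] in its level-[n] atom; the midpoint corresponds to $1/2$. *)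
Definition dyadic_frac n x : R := 2 ^+ n * x - (dyadic_index n x)%:R.

Lemma dyadic_index_itv n x : 0 <= x ->
  (dyadic_index n x)%:R <= 2 ^+ n * x < (dyadic_index n x).+1%:R.
Proof. by move=> x0; rewrite truncn_itv// mulr_ge0// exprn_ge0. Qed.

(* Unqualified, [dyadic_itv] is the library's constant of the same name. *)
Lemma mem_dyadic_itv n j x : Defs.dyadic_itv n j x <-> j%:R <= 2 ^+ n * x < j.+1%:R.
Proof.
by rewrite /Defs.dyadic_itv/= in_itv/= ler_pdivrMr ?ltr_pdivlMr ?exprn_gt0// [x * _]mulrC.
Qed.

Lemma dyadic_itvP n j x : 0 <= x -> Defs.dyadic_itv n j x <-> dyadic_index n x = j.
Proof.
move=> x0; rewrite mem_dyadic_itv; split; first exact: truncn_def.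
by move=> <-; exact: dyadic_index_itv.
Qed.

Lemma dyadic_index_lt n x : 0 <= x < 1 -> (dyadic_index n x < 2 ^ n)%N.
Proof.
move=> /andP[x0 x1]; rewrite truncn_lt_nat ?mulr_ge0 ?exprn_ge0//.
by rewrite natrX gtr_pMr// exprn_gt0.
Qed.

Lemma dyadic_frac_itv n x : 0 <= x -> 0 <= dyadic_frac n x < 1.
Proof.
move=> /(dyadic_index_itv n); rewrite /dyadic_frac -natr1; lra.
Qed.

(** Halving atom number $d$ produces atoms $2d$ and $2d+1$; comparing the relative position with
    $1/2$ decides which half contains [x]. *)
Lemma dyadic_fracS n x : 0 <= x ->
  dyadic_frac n.+1 x =
  if dyadic_frac n x < 1 / 2 then 2 * dyadic_frac n x else 2 * dyadic_frac n x - 1.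
Proof.
move=> x0; have := dyadic_frac_itv n x0; rewrite /dyadic_frac.
have S_natr (k : nat) : k.+1%:R = k%:R + 1 :> R by rewrite natr1.
set d := dyadic_index n x.
move=> f01; have [f1|f1] := ltP (2 ^+ n * x - d%:R) (1 / 2).
- suff -> : dyadic_index n.+1 x = (2 * d)%N.
    by rewrite natrM exprS; ring.
  by apply: truncn_def; rewrite exprS (S_natr (2 * d)%N) natrM; lra.
- suff -> : dyadic_index n.+1 x = (2 * d).+1.
    by rewrite (S_natr (2 * d)%N) natrM exprS; ring.
  by apply: truncn_def; rewrite exprS (S_natr (2 * d).+1) (S_natr (2 * d)%N) natrM; lra.
Qed.

(** The partitions are nested: each atom of level [m] is made of $2^{n-m}$ consecutive atoms of
    level [n]. Hence functions constant on level-[m] atoms are constant on level-[n] atoms. *)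
Lemma dyadic_index_coarsen m n x : (m <= n)%N -> 0 <= x ->
  dyadic_index m x = (dyadic_index n x %/ 2 ^ (n - m))%N.
Proof.
move=> mn x0; have /andP[l u] := dyadic_index_itv n x0.
set j := dyadic_index n x in l u *.
have e : 2 ^+ n = (2 ^ (n - m))%:R * 2 ^+ m :> R by rewrite natrX -exprD subnK.
have d0 : 0 < (2 ^ (n - m))%:R :> R by rewrite ltr0n expn_gt0.
apply: truncn_def; rewrite -(ler_pM2l d0) -(ltr_pM2l d0) !mulrA -e -!natrM.
rewrite (le_trans _ l) ?ler_nat 1?mulnC ?leq_divM//=.
by rewrite (lt_le_trans u)// ler_nat ltn_ceil ?expn_gt0.
Qed.

End dyadic_digits.

(** * Lebesgue measure on the unit interval *)

Section lebesgue01_theory.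
Context (R : realType).
Local Notation mu := (@lebesgue01 R).
Local Notation leb := (@lebesgue_measure R).
Implicit Types (f g : R -> R) (x c t : R).

Lemma lebesgue01_sub (A : set R) : A `<=` `[0, 1] -> mu A = leb A.
Proof. by move=> A01; rewrite /lebesgue01/= /mrestr setIidl. Qed.

Lemma lebesgue01_setT : mu setT = 1%E.
Proof.
by rewrite /lebesgue01/= /mrestr setTI lebesgue_measure_itv/= lte_fin ltr01 sube0.
Qed.

Lemma lebesgue01_lty (A : set R) : measurable A -> (mu A < +oo)%E.
Proof.
move=> mA; rewrite (@le_lt_trans _ _ (mu setT)) ?le_measure ?inE//.
by rewrite lebesgue01_setT ltry.
Qed.

Lemma lebesgue01_fin_num (A : set R) : measurable A -> mu A \is a fin_num.
Proof. by move=> mA; rewrite ge0_fin_numE// lebesgue01_lty. Qed.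

Lemma integral_lebesgue01 (D : set R) (f : R -> \bar R) : D `<=` `[0, 1] ->
  (\int[mu]_(x in D) f x = \int[leb]_(x in D) f x)%E.
Proof.
move=> D01; apply: eq_measure_integral => A mA AD.
by apply: lebesgue01_sub; exact: subset_trans D01.
Qed.

Lemma ge0_integral_lebesgue01T (f : R -> \bar R) :
  measurable_fun setT f -> (forall x, 0 <= f x)%E ->
  (\int[mu]_x f x = \int[leb]_(x in `[0%R, 1%R]) f x)%E.
Proof.
move=> mf f0; rewrite (@ge0_negligible_integral _ (measurableTypeR R) R mu setT (~` `[0, 1]))//.
- by rewrite setTD setCK integral_lebesgue01.
- exact: measurableC.
- by rewrite /= /lebesgue01/= /mrestr setICl measure0.
Qed.

Lemma integrable_lebesgue01T f : measurable_fun setT f ->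
  mu.-integrable setT (EFin \o f) <-> leb.-integrable `[0, 1] (EFin \o f).
Proof.
move=> mf; split => /integrableP[_ intf]; apply/integrableP; split.
- by apply/measurable_EFinP; exact: measurable_funTS.
- rewrite -ge0_integral_lebesgue01T//.
  by do 2 apply: measurableT_comp => //.
- exact/measurable_EFinP.
- rewrite ge0_integral_lebesgue01T//.
  by do 2 apply: measurableT_comp => //.
Qed.

Lemma subset_dyadic_itv n j : (j < 2 ^ n)%N -> Defs.dyadic_itv n j `<=` `[(0:R), 1].
Proof.
move=> jn x /mem_dyadic_itv /andP[l u].
have n0 : 0 < 2 ^+ n :> R by rewrite exprn_gt0.
rewrite /= in_itv/= -(pmulr_rge0 _ n0) (le_trans _ l)//=.
rewrite -(ler_pM2l n0) mulr1 (le_trans (ltW u))//.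
by rewrite -natrX ler_nat.
Qed.

Lemma measurable_dyadic_itv n j : measurable (Defs.dyadic_itv n j : set R).
Proof. exact: measurable_itv. Qed.

Lemma lebesgue01_dyadic_itv n j : (j < 2 ^ n)%N ->
  mu (Defs.dyadic_itv n j) = (1 / 2 ^+ n)%:E.
Proof.
move=> jn; rewrite lebesgue01_sub; last exact: subset_dyadic_itv.
rewrite /Defs.dyadic_itv lebesgue_measure_itv/= lte_fin.
rewrite ltr_pM2r ?invr_gt0 ?exprn_gt0// ltr_nat ltnSn -EFinB -natr1.
by congr EFin; ring.
Qed.

(** An affine function averages to its value at the midpoint. The primitive [F] and the fundamental
    theorem of calculus give the value. *)
Lemma integral_affine (a b c t : R) : a < b ->
  \int[leb]_(x in `[a, b[) (c + t * x) = (b - a) * (c + t * ((a + b) / 2)).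
Proof.
move=> ab.
pose F (y : R) := c * y + t * (y ^+ 2 / 2).
have dF (y : R) : is_derive y 1 F (c + t * y).
  by apply: is_derive_eq; rewrite /GRing.scale/=; field.
have cf : continuous (fun x => c + t * x).
  by move=> x; apply: cvgD; [exact: cvg_cst|apply: cvgMr; exact: cvg_id].
have cF : continuous F.
  by move=> x; apply: differentiable_continuous; apply/derivable1_diffP; case: (dF x).
rewrite /Rintegral integral_itv_bndo_bndc; last first.
  by apply/measurable_EFinP; apply: measurable_funTS; exact: continuous_measurable_fun.
rewrite (@continuous_FTC2 _ _ F)//.
- by rewrite /F /=; field.
- by apply: continuous_subspaceT.
- split=> [x _||]; first by case: (dF x).
  + by apply: cvg_at_right_filter; exact: cF.
  + by apply: cvg_at_left_filter; exact: cF.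
- by move=> x _; rewrite derive1E; case: (dF x).
Qed.

End lebesgue01_theory.

(** * Step functions plus a linear function *)

Section dyadic_step.
Context (R : realType).
Local Notation mu := (@lebesgue01 R).
Local Notation leb := (@lebesgue_measure R).
Implicit Types (f g : R -> R) (x t : R) (c : nat -> R).

Definition dyadic_step n c x : R :=
  \sum_(j < 2 ^ n) c j * \1_(Defs.dyadic_itv n j) x.

Lemma dyadic_stepE n c x : 0 <= x < 1 -> dyadic_step n c x = c (dyadic_index n x).
Proof.
move=> x01; have x0 : 0 <= x by case/andP: x01.
rewrite /dyadic_step (bigD1 (Ordinal (dyadic_index_lt n x01)))//=.
rewrite indicE mem_set ?mulr1; last exact/dyadic_itvP.
rewrite big1 ?addr0// => j jx; rewrite indicE memNset ?mulr0//.
by move=> /(dyadic_itvP _ _ x0) xj; move/eqP: jx; apply; exact/val_inj.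
Qed.

Lemma measurable_dyadic_step n c : measurable_fun setT (dyadic_step n c).
Proof.
apply: measurable_sum => j; apply: measurable_funM => //.
exact: measurable_indic (measurable_dyadic_itv _ _).
Qed.

Lemma dyadic_condexpE n f x : 0 <= x < 1 ->
  dyadic_condexp n f x = dyadic_average n (dyadic_index n x) f.
Proof. exact: (@dyadic_stepE n (fun j => dyadic_average n j f)). Qed.

Lemma measurable_dyadic_condexp n f : measurable_fun setT (dyadic_condexp n f).
Proof. exact: (@measurable_dyadic_step n (fun j => dyadic_average n j f)). Qed.

Lemma dyadic_average_affine n j f a t : (j < 2 ^ n)%N ->
  {in Defs.dyadic_itv n j, forall y, f y = a + t * y} ->
  dyadic_average n j f = a + t * ((j%:R + 1 / 2) / 2 ^+ n).
Proof.
move=> jn faff; rewrite /dyadic_average lebesgue01_dyadic_itv//=.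
have n0 : 2 ^+ n != 0 :> R by rewrite expf_neq0.
rewrite (@eq_Rintegral _ (measurableTypeR R) R mu _ _ f faff) /Rintegral integral_lebesgue01; last exact: subset_dyadic_itv.
rewrite -/(Rintegral _ _ _) integral_affine -?natr1; last first.
  by rewrite ltr_pM2r ?invr_gt0 ?exprn_gt0// ltrDl ltr01.
by field.
Qed.

(** On a level-[n] atom with $n \ge m$ the step part is constant and cancels. What remains is [t]
    times the midpoint minus [x], written in units of the atom length $2^{-n}$. *)
Lemma dyadic_condexp_step_affine m n c t x : (m <= n)%N -> 0 <= x < 1 ->
  let f y := dyadic_step m c y + t * y in
  dyadic_condexp n f x - f x = t * (1 / 2 - dyadic_frac n x) / 2 ^+ n.
Proof.
move=> mn x01 f; have x0 : 0 <= x by case/andP: x01.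
rewrite dyadic_condexpE// (@dyadic_average_affine _ _ _ (c (dyadic_index m x)) t).
- by rewrite /f dyadic_stepE// /dyadic_frac; field; rewrite expf_neq0.
- exact: dyadic_index_lt.
- move=> y /set_mem nxy; rewrite /f.
  have := subset_dyadic_itv (dyadic_index_lt n x01) nxy.
  rewrite /= in_itv/= => /andP[y0 _].
  have y01 : 0 <= y < 1.
    rewrite y0; move/mem_dyadic_itv : nxy => /andP[_ /lt_le_trans].
    move=> /(_ (2 ^+ n * 1)); rewrite ltr_pM2l ?exprn_gt0//; apply.
    by rewrite mulr1 -natrX ler_nat dyadic_index_lt.
  move/(dyadic_itvP _ _ y0) in nxy.
  by rewrite dyadic_stepE// !(dyadic_index_coarsen mn)// nxy.
Qed.

End dyadic_step.

Definition dyadic_oscillating (R : realType) (f : R -> R) x :=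
  forall N, (exists2 n, (N <= n)%N & f x < dyadic_condexp n f x) /\
            (exists2 n, (N <= n)%N & dyadic_condexp n f x < f x).

Lemma step_affine_oscillates (R : realType) m c (t x : R) :
    0 < t -> 0 <= x < 1 -> ~ rational x ->
  dyadic_oscillating (fun y => dyadic_step m c y + t * y) x.
Proof.
move=> t0 x01 xQ N; have x0 : 0 <= x by case/andP: x01.
have [||[n Nn un] [k Nk uk]] :=
    (* Beyond [maxn m N] an index is both past [N] and fine enough for the step part to cancel. *)
    @doubling_map_oscillates _ (fun n => dyadic_frac n x) _ _ (maxn m N).
- move=> n; have /andP[f0 ->] := dyadic_frac_itv n x0; rewrite lt_neqAle f0 !andbT.
  (* A vanishing fractional part would make [x] a dyadic rational. *)
  apply: contra_notN xQ => /eqP/esym/eqP; rewrite subr_eq0 => /eqP xn.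
  apply/rationalP; exists (Posz (dyadic_index n x)), (2 ^ n)%N.
  by rewrite natrX -pmulrn -xn mulrAC mulfV ?mul1r// expf_neq0.
- by move=> n; exact: dyadic_fracS.
- rewrite !geq_max in Nn Nk; case/andP: Nn => mn Nn; case/andP: Nk => mk Nk.
  have p0 i : 0 < t / 2 ^+ i by rewrite divr_gt0 ?exprn_gt0.
  split; [exists n|exists k] => //.
  + rewrite -subr_gt0 dyadic_condexp_step_affine// mulrAC pmulr_rgt0// subr_gt0//.
  + rewrite -subr_lt0 dyadic_condexp_step_affine// mulrAC pmulr_rlt0// subr_lt0//.
Qed.

(** * Density of step functions plus a linear term of positive slope *)

Section density.
Context (R : realType).
Local Notation mu := (@lebesgue01 R).
Local Notation leb := (@lebesgue_measure R).
Implicit Types (f g : R -> R) (x t : R) (c : nat -> R).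

Lemma cvg_ereal_lt (u : (\bar R)^nat) (l y : \bar R) :
  u @ \oo --> l -> (l < y)%E -> exists n, (u n < y)%E.
Proof.
move=> ul ly; have [k _ /(_ _ (leqnn k)) /= uk] := ul _ (open_ereal_lt' ly).
by exists k.
Qed.

Lemma cvg_inv_exp2 : (2 ^+ n)^-1 @[n --> \oo] --> (0 : R).
Proof.
under eq_fun do rewrite -exprVn.
by apply: cvg_expr; rewrite ger0_norm ?invr_ge0// invf_lt1// ltr1n.
Qed.

Lemma cvg_dyadic_index x : 0 <= x ->
  (dyadic_index n x)%:R / 2 ^+ n @[n --> \oo] --> x.
Proof.
move=> x0; apply: (@squeeze_cvgr _ _ _ _ (fun n => x - (2 ^+ n)^-1) (cst x)).
- near=> n; have /andP[f0 f1] := dyadic_frac_itv n x0; apply/andP; split => /=.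
  + rewrite ler_pdivlMr ?exprn_gt0// mulrBl mulVf ?expf_neq0// [x * _]mulrC.
    by move: f1; rewrite /dyadic_frac; lra.
  + by rewrite ler_pdivrMr ?exprn_gt0// [x * _]mulrC -subr_ge0.
- rewrite -[X in _ --> X]subr0; apply: cvgB; [exact: cvg_cst|exact: cvg_inv_exp2].
- exact: cvg_cst.
Unshelve. all: by end_near. Qed.

Lemma measurable_step_affine m c t :
  measurable_fun setT (fun y : R => dyadic_step m c y + t * y).
Proof.
apply: measurable_funD; first exact: measurable_dyadic_step.
by apply: measurable_funM => //; exact: measurable_id.
Qed.

(** Sampling [g] at the left endpoints of the atoms and adding the slope $2^{-n}$, positive but
    vanishing in the limit, gives functions [h n] that converge pointwise to [g]. Dominated
    convergence turns this into convergence in $L^1$. *)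
Lemma step_affine_approx_continuous g (e : R) : continuous g -> 0 < e ->
  exists m c t, 0 < t /\
    (\int[mu]_x `|g x - (dyadic_step m c x + t * x)|%:E < e%:E)%E.
Proof.
move=> cg e0.
have mg : measurable_fun setT g by exact: continuous_measurable_fun.
pose c n i := g (i%:R / 2 ^+ n).
pose h n x := dyadic_step n (c n) x + (2 ^+ n)^-1 * x.
have mh n : measurable_fun setT (h n) by exact: measurable_step_affine.
have [M Mg] : exists M : R, forall x, `[0, 1]%classic x -> `|g x| <= M.
  have /compact_bounded[M [_ Mg]] : compact (g @` `[0, 1]).
    by apply: continuous_compact; [exact: continuous_subspaceT|exact: segment_compact].
  have M1 : M < M + 1 by rewrite ltrDl.
  by exists (M + 1) => x x01; apply: (Mg _ M1); exists x.
(* The limit is taken on the half-open interval because the atoms do not cover the point $1$; the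
   endpoint is restored at the end as a null set. *)
have leb01 : (leb `[0%R, 1%R[ < +oo)%E.
  by rewrite lebesgue_measure_itv/= lte_fin ltr01 -EFinB ltry.
have [||||||_ cvg0 _] := @dominated_convergence _ (measurableTypeR R) R leb `[0, 1[
    _ (fun n => EFin \o h n) (EFin \o g) (cst (M + 1)%:E).
- exact: measurable_itv.
- by move=> n; apply/measurable_EFinP; apply: measurable_funTS; exact: mh.
- by apply/measurable_EFinP; apply: measurable_funTS; exact: mg.
- apply: aeW => x /=; rewrite in_itv/= => x01.
  apply: cvg_EFin; first by near=> n.
  rewrite -[X in _ --> X]addr0 -(mul0r x); apply: cvgD.
    under eq_fun do rewrite dyadic_stepE//.
    by apply: (continuous_cvg _ (cg x)); apply: cvg_dyadic_index; case/andP: x01.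
  by apply: cvgMl; exact: cvg_inv_exp2.
- apply: (@measurable_bounded_integrable _ (measurableTypeR R) R leb) => //.
  by exists `|M + 1|; split; [exact: normr_real|move=> ? /ltW ? ? _].
(* The dominating constant is [M + 1]: the sampled values are bounded by [M] and the linear term by
   $1$. *)
- apply: aeW => x n /=; rewrite in_itv/= => x01; rewrite lee_fin.
  rewrite /h dyadic_stepE// (le_trans (ler_normD _ _))// lerD//.
    apply: Mg; rewrite /= in_itv/= divr_ge0 ?exprn_ge0//=.
    by rewrite ler_pdivrMr ?exprn_gt0// mul1r -natrX ler_nat ltnW// dyadic_index_lt.
  case/andP: x01 => x0 /ltW x1; rewrite ger0_norm ?mulr_ge0// ?invr_ge0 ?exprn_ge0//.
  by rewrite mulr_ile1// ?invr_ge0 ?exprn_ge0// invf_le1 ?exprn_gt0// exprn_ege1// ler1n.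
have [|m /= hm] := cvg_ereal_lt cvg0 (_ : 0 < e%:E)%E; first by rewrite lte_fin.
exists m, (c m), (2 ^+ m)^-1; split; first by rewrite invr_gt0 exprn_gt0.
rewrite ge0_integral_lebesgue01T//; last first.
  do 2 apply: measurableT_comp => //; apply: measurable_funB => //; exact: mh.
rewrite -integral_itv_bndo_bndc; last first.
  apply: measurable_funTS.
  do 2 apply: measurableT_comp => //; apply: measurable_funB => //; exact: mh.
apply: le_lt_trans hm; under eq_integral do rewrite distrC; exact: lexx.
Unshelve. all: by end_near. Qed.

(** Continuous functions are dense in $L^1$, so half of [e] is spent on a continuous approximation
    and half on the previous lemma. *)
Lemma step_affine_dense f (e : R) : mu.-integrable setT (EFin \o f) -> 0 < e ->
  exists m c t, 0 < t /\
    (\int[mu]_x `|f x - (dyadic_step m c x + t * x)|%:E < e%:E)%E.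
Proof.
move=> intf e0.
have mf : measurable_fun setT f by case/integrableP : intf => /measurable_EFinP.
have leb01 : (leb `[0%R, 1%R] < +oo)%E.
  by rewrite lebesgue_measure_itv/= lte_fin ltr01 -EFinB ltry.
have [g_ [cg_ _ g_f]] := approximation_continuous_integrable
  (measurable_itv `[0, 1]) leb01 ((integrable_lebesgue01T mf).1 intf).
have e20 : 0 < e / 2 by rewrite divr_gt0.
have [|k] := cvg_ereal_lt g_f (_ : 0 < (e / 2)%:E)%E; first by rewrite lte_fin.
set g := g_ k => fg.
have [m [c [t [t0 gh]]]] := step_affine_approx_continuous (cg_ k) e20.
exists m, c, t; split => //.
have mg : measurable_fun setT g by apply: continuous_measurable_fun; exact: cg_.
have mh := measurable_step_affine m c t.
have mfg : measurable_fun setT (fun x => `|f x - g x|%:E).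
  by do 2 apply: measurableT_comp => //; exact: measurable_funB.
have mgh : measurable_fun setT (fun x => `|g x - (dyadic_step m c x + t * x)|%:E).
  by do 2 apply: measurableT_comp => //; exact: measurable_funB.
rewrite -ge0_integral_lebesgue01T// in fg.
rewrite [e]splitr EFinD; apply: le_lt_trans (lteD fg gh).
rewrite -ge0_integralD//; apply: ge0_le_integral => //.
- by do 2 apply: measurableT_comp => //; exact: measurable_funB.
- exact: emeasurable_funD.
- by move=> x _; rewrite -EFinD lee_fin ler_distD.
Qed.

End density.

(** * Oscillation as a countable family of open conditions *)

Section oscillation_Gdelta.
Context (R : realType).
Local Notation mu := (@lebesgue01 R).
Local Notation leb := (@lebesgue_measure R).
Implicit Types (f g : R -> R) (x s : R) (N M n k : nat).

(** Each atom has measure $2^{-n}$, so an average over it moves by at most $2^n \|f-g\|_1$. Dropping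
    the indicators and summing over all $2^n$ atoms gives the crude constant $4^n$; only its
    independence of [x], [f] and [g] matters. *)
Lemma dyadic_condexp_lipschitz n f g x :
    mu.-integrable setT (EFin \o f) -> mu.-integrable setT (EFin \o g) ->
  `|dyadic_condexp n f x - dyadic_condexp n g x|
    <= 4 ^+ n * \int[mu]_y `|f y - g y|.
Proof.
move=> intf intg.
have intfg : mu.-integrable setT (fun y => `|f y - g y|%:E).
  by have := integrable_abse (integrableB measurableT intf intg).
have n0 : 0 < 2 ^+ n :> R by rewrite exprn_gt0.
rewrite /dyadic_condexp -sumrB (le_trans (ler_norm_sum _ _ _))//.
have -> : 4 ^+ n * \int[mu]_y `|f y - g y| =
    \sum_(j < 2 ^ n) 2 ^+ n * \int[mu]_y `|f y - g y|.
  rewrite sumr_const card_ord -[RHS]mulr_natr natrX mulrAC -exprMn.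
  by congr (_ ^+ _ * _); rewrite -natrM.
apply: ler_sum => j _.
rewrite -mulrBl normrM (le_trans (ler_piMr _ _))//.
  by rewrite ger0_norm indicE ?ler0n//; case: (_ \in _).
rewrite /dyadic_average -mulrBl lebesgue01_dyadic_itv//= div1r invrK.
rewrite normrM [`|2 ^+ n|]gtr0_norm// mulrC ler_pM2l//.
have mI : measurable (Defs.dyadic_itv n j : set (measurableTypeR R)) by exact: measurable_dyadic_itv.
have intI h : mu.-integrable setT h -> mu.-integrable (Defs.dyadic_itv n j) h.
  exact: integrableS.
rewrite -(@RintegralB _ (measurableTypeR R) R mu)//; [|exact: intI..].
rewrite (le_trans (@le_normr_Rintegral _ (measurableTypeR R) R mu _ _ _ _))//.
  by have := integrableB mI (intI _ intf) (intI _ intg).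
rewrite fine_le ?integrable_fin_num//; first exact: intI.
apply: ge0_subset_integral => //.
by case/integrableP: intfg.
Qed.

(** The points where no excess of size [d] in the direction of the sign [s] is seen in the window
    from [N] to [M]. *)
Definition stuck s N M (d : R) f : set R :=
  [set x | forall n, (N <= n <= M)%N -> s * (dyadic_condexp n f x - f x) < d].

Lemma measurable_stuck s N M d f : measurable_fun setT f ->
  measurable (stuck s N M d f).
Proof.
move=> mf.
have -> : stuck s N M d f = \bigcap_(n in [set n | (N <= n <= M)%N])
    ((fun x => s * (dyadic_condexp n f x - f x)) @^-1` `]-oo, d[).
  by apply/seteqP; split => x h n /h; rewrite /= in_itv.
apply: bigcap_measurableType => // n _; rewrite -[X in measurable X]setTI.
apply: (_ : measurable_fun (setT : set (measurableTypeR R)) _) => //.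
apply: measurable_funM => //; apply: measurable_funB => //.
exact: measurable_dyadic_condexp.
Qed.

(** The margin [d] is split in three: a third for the change of the conditional expectation, a third
    for the change of the function off the set [far], and a third left as the margin for [g]. *)
Lemma stuck_stable s N M d f g : `|s| <= 1 -> 0 < d ->
    mu.-integrable setT (EFin \o f) -> mu.-integrable setT (EFin \o g) ->
    4 ^+ M * \int[mu]_y `|f y - g y| <= d / 3 ->
  (mu (stuck s N M (d / 3) g) <=
   mu (stuck s N M d f) + (3 / d * \int[mu]_y `|f y - g y|)%:E)%E.
Proof.
move=> s1 d0 intf intg rd.
have mf : measurable_fun setT f by case/integrableP : intf => /measurable_EFinP.
have mg : measurable_fun setT g by case/integrableP : intg => /measurable_EFinP.
have mfg : measurable_fun setT (fun y => (f y - g y)%:E).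
  by apply/measurable_EFinP; exact: measurable_funB.
have r0 : 0 <= \int[mu]_y `|f y - g y| by exact: Rintegral_ge0.
have d3 : 0 < d / 3 by rewrite divr_gt0.
pose far := [set: R] `&` [set y | ((d / 3)%:E <= `|(f y - g y)%:E|)%E].
have mfar : measurable far.
  by apply: emeasurable_fun_c_infty => //; exact: measurableT_comp.
have mu_far : (mu far <= (3 / d * \int[mu]_y `|f y - g y|)%:E)%E.
  (* Markov's inequality for $|f-g|$ at level $d/3$. *)
  have := @le_integral_comp_abse _ (measurableTypeR R) R mu _ measurableT
    (fun y => (f y - g y)%:E) _ id (@measurable_id _ _ _) (fun r r0 => r0)
    (fun _ _ _ _ h => h) mfg d3.
  rewrite -[X in (_ <= X)%E -> _]fineK => [|]; last first.
    apply: integrable_fin_num => //.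
    by have := integrable_abse (integrableB measurableT intf intg).
  rewrite -/far -[mu far]fineK ?lebesgue01_fin_num// -EFinM !lee_fin.
  by rewrite mulrC -ler_pdivlMr// invf_div mulrC.
apply: (@le_trans _ _ (mu (stuck s N M d f `|` far))).
  apply: le_measure; rewrite ?inE.
  - exact: measurable_stuck.
  - by apply: measurableU => //; exact: measurable_stuck.
  move=> x gx; have [|ffar] := leP (d / 3) `|f x - g x|; first by right.
  left => n nNM; have := gx _ nNM.
  have := dyadic_condexp_lipschitz n x intf intg.
  set a := dyadic_condexp n f x; set b := dyadic_condexp n g x => ab gn.
  have {}ab : `|a - b| <= d / 3.
    rewrite (le_trans ab)// (le_trans _ rd)// ler_wpM2r// ler_weXn2l//.
      by rewrite ler1n.
    by case/andP : nNM.
  have sab : s * (a - b) <= d / 3.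
    rewrite (le_trans (ler_norm _))// normrM (le_trans _ ab)//.
    by rewrite ler_piMl.
  have sfg : s * (g x - f x) < d / 3.
    rewrite (le_lt_trans _ ffar)// (le_trans (ler_norm _))// normrM distrC.
    by rewrite ler_piMl.
  have -> : s * (a - f x) = s * (a - b) + s * (g x - f x) + s * (b - g x) by ring.
  by rewrite [d](_ : _ = d / 3 + d / 3 + d / 3); [apply: ltrD => //; exact: ler_ltD|field].
apply: le_trans (measureU2 _ _ _) _ => //; first exact: measurable_stuck.
by rewrite leeD2l.
Qed.

(* The margin [d] and the finite window of [n] make this condition open in L^1;
   it holds for all [k] and [s = 1, -1] iff [f] oscillates a.e. *)
Definition escapes s k f := exists M d,
  0 < d /\ (mu (stuck s k M d f) < k.+1%:R^-1%:E)%E.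

Lemma escapes_open s k f : `|s| <= 1 -> mu.-integrable setT (EFin \o f) ->
  escapes s k f -> exists2 e : R, 0 < e &
    forall g, mu.-integrable setT (EFin \o g) ->
      (\int[mu]_y `|f y - g y|%:E < e%:E)%E -> escapes s k g.
Proof.
move=> s1 intf [M [d [d0 fk]]].
have mf : measurable_fun setT f by case/integrableP : intf => /measurable_EFinP.
have fin_stuck : mu (stuck s k M d f) \is a fin_num.
  by apply: lebesgue01_fin_num; exact: measurable_stuck.
move: fk; rewrite -(fineK fin_stuck) lte_fin -subr_gt0.
set eta := (X in 0 < X) => eta0.
(* The first bound meets the Lipschitz condition of [stuck_stable] for the window ending at [M]; the
   second keeps the added measure $(3/d)\|f-g\|_1$ below the slack [eta]. *)
exists (Num.min (d / 3 / 4 ^+ M) (d / 3 * eta)).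
  by rewrite lt_min !divr_gt0 ?mulr_gt0 ?divr_gt0 ?exprn_gt0.
move=> g intg; rewrite -[X in (X < _)%E -> _]fineK; last first.
  apply: integrable_fin_num => //.
  by have := integrable_abse (integrableB measurableT intf intg).
rewrite lte_fin lt_min => /andP[r1 r2].
exists M, (d / 3); split; first by rewrite divr_gt0.
rewrite (le_lt_trans (stuck_stable k s1 d0 intf intg _))//.
  by rewrite mulrC -ler_pdivlMr ?exprn_gt0// ltW.
rewrite -(fineK fin_stuck) -EFinD lte_fin addrC -ltrBrDr -/eta.
by rewrite -ltr_pdivlMl ?divr_gt0// invf_div.
Qed.

(** A single [M] governs both the window, which grows, and the margin $1/(M+1)$, which shrinks. The
    stuck sets thus decrease in [M], and their intersection consists of the points with no positive
    excess from [N] on. *)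
Lemma stuckP s N f x :
  (exists2 n, (N <= n)%N & 0 < s * (dyadic_condexp n f x - f x)) <->
  exists M, ~ stuck s N M M.+1%:R^-1 f x.
Proof.
split=> [[n Nn sn]|[M]].
- have [k _ /(_ _ (leqnn k)) /= kn] := near_infty_natSinv_lt (PosNum sn).
  exists (maxn n k) => /(_ n); rewrite Nn leq_maxl => /(_ isT).
  apply/negP; rewrite -leNgt (le_trans _ (ltW kn))// lef_pV2 ?posrE// ler_nat.
  by rewrite ltnS leq_maxr.
- move=> /existsNP[n /not_implyP[/andP[Nn _] /negP]].
  rewrite -leNgt => dn; exists n => //; apply: lt_le_trans dn.
  by rewrite invr_gt0.
Qed.

(** The sets [F M] decrease to a set of non-oscillating points, which is null. As the measure is
    finite, continuity from above makes some [F M] smaller than $1/(k+1)$. *)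
Lemma ae_oscillating_escapes s k f : `|s| = 1 -> measurable_fun setT f ->
  mu.-negligible [set x | ~ dyadic_oscillating f x] -> escapes s k f.
Proof.
move=> s1 mf nosc.
pose F M := stuck s k M M.+1%:R^-1 f.
have mF M : measurable (F M) by exact: measurable_stuck.
have FN0 : mu (\bigcap_M F M) = 0%E.
  apply: measure_negligible; first by apply: bigcap_measurableType => M _; exact: mF.
  apply: negligibleS nosc => x Fx /(_ k) [[n kn up] [m km dn]].
  suff [n' kn' sn'] : exists2 n, (k <= n)%N & 0 < s * (dyadic_condexp n f x - f x).
    have [M] := (stuckP s k f x).1 (ex_intro2 _ _ n' kn' sn'); apply; exact: Fx.
  move/eqP : s1; rewrite eqr_norml => /andP[/orP[]/eqP-> _].
  - by exists n; rewrite // mul1r subr_gt0.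
  - by exists m; rewrite // mulN1r oppr_gt0 subr_lt0.
have [||M FM] := @cvg_ereal_lt _ (mu \o F) (mu (\bigcap_M F M)) k.+1%:R^-1%:E.
- apply: nonincreasing_cvg_mu => //.
  + exact: lebesgue01_lty.
  + by apply: bigcap_measurableType => M _; exact: mF.
  + move=> m n mn; apply/subsetPset => x Fx i /andP[ki im].
    rewrite (lt_le_trans (Fx i _)) ?ki ?(leq_trans im)//.
    by rewrite lef_pV2 ?posrE// ler_nat.
- by rewrite FN0 lte_fin invr_gt0.
by exists M, M.+1%:R^-1; rewrite invr_gt0.
Qed.

(** A point with no positive excess from [N] on is stuck in every window starting at or after [N],
    whatever the margin. [B N] therefore lies in sets of arbitrarily small measure, and the
    exceptional set is the countable union of the [B N]. *)
Lemma escapes_ae s f : measurable_fun setT f -> (forall k, escapes s k f) ->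
  mu.-negligible [set x | exists N, forall n, (N <= n)%N ->
    s * (dyadic_condexp n f x - f x) <= 0].
Proof.
move=> mf esc.
pose B N : set R := \bigcap_M stuck s N M M.+1%:R^-1 f.
have mB N : measurable (B N) by apply: bigcap_measurableType => // M _; exact: measurable_stuck.
have muB N : mu (B N) = 0%E.
  apply/eqP; rewrite -measure_le0; apply/lee_addgt0Pr => e e0; rewrite add0e.
  have [k _ /(_ (maxn k N) (leq_maxl _ _)) /= ke] := near_infty_natSinv_lt (PosNum e0).
  (* Starting at [maxn k N] makes the measure bound smaller than [e] and keeps the window past
     [N]. *)
  have [M [d [d0 stM]]] := esc (maxn k N).
  apply: le_trans (ltW _); last by apply: lt_trans stM _; rewrite lte_fin; exact: ke.
  apply: le_measure; rewrite ?inE; [exact: mB|exact: measurable_stuck|].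
  move=> x Bx n /andP[kn nM]; rewrite ltNge; apply/negP => dn.
  have [|M'] := (stuckP s N f x).1; last by apply; exact: Bx.
  by exists n; [exact: leq_trans (leq_maxr _ _) kn|exact: lt_le_trans dn].
apply: (@negligibleS _ _ _ mu (\bigcup_N B N)); last first.
  apply: negligible_bigcup => N.
  by exists (B N); split; [exact: mB|exact: muB|].
move=> x [N xN]; exists N => // M _ n /andP[Nn _].
by rewrite (le_lt_trans (xN _ Nn))// invr_gt0.
Qed.

End oscillation_Gdelta.

(** * Elements of $L^1$ and their representatives *)

Section L1space_theory.
Context d (T : measurableType d) (R : realType) (mu : {measure set T -> \bar R}).
Implicit Types (G H : L1space mu) (e : R).

Lemma measurable_L1space G : measurable_fun [set: T] (G : T -> R).
Proof. by case: G => G ?; exact: (measurable_funPT (repr G)). Qed.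

Lemma integrable_L1space G : mu.-integrable setT (EFin \o (G : T -> R)).
Proof.
have mG := measurable_L1space G.
apply/integrableP; split; first exact/measurable_EFinP.
by rewrite -Lnorm1; exact: Lebesgue_finite.
Qed.

Lemma ball_L1spaceE G e H :
  ball G e H <-> (\int[mu]_x `|G x - H x|%:E < e%:E)%E.
Proof.
have iGH : (\int[mu]_x `|G x - H x|%:E)%E \is a fin_num.
  rewrite ge0_fin_numE ?integral_ge0//.
  have := integrableB measurableT (integrable_L1space G) (integrable_L1space H).
  by case/integrableP.
suff -> : (\int[mu]_x `|G x - H x|%:E = (L1dist G H)%:E)%E.
  by rewrite lte_fin.
by rewrite /L1dist Lnorm1 fineK.
Qed.

(** The witness is the class of [f]. Coercing it back to a function uses a chosen representative,
    known to agree with [f] only almost everywhere. *)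
Lemma exists_L1space (f : T -> R) : mu.-integrable setT (EFin \o f) ->
  exists G : L1space mu, (G : T -> R) = f %[ae mu].
Proof.
move=> intf; have mf : measurable_fun setT f by case/integrableP : intf => /measurable_EFinP.
pose g : {mfun T >-> measurableTypeR R} := HB.pack f (isMeasurableFun.Build _ _ T (measurableTypeR R) f mf).
pose q : {mfun_ mu, T >-> measurableTypeR R} := (\pi g)%qT.
have qf : (q : T -> R) = f %[ae mu].
  have : (repr q = g %[mod {mfun_ mu, T >-> measurableTypeR R}])%qT := reprK q.
  by move=> /eqquotP/asboolP.
have finq : finite_norm mu 1 (q : T -> R).
  rewrite /finite_norm Lnorm1; case/integrableP : intf => _.
  apply: le_lt_trans; rewrite le_eqVlt; apply/orP; left; apply/eqP.
  apply: ge0_ae_eq_integral => //.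
  - do 2 apply: measurableT_comp => //; exact: (measurable_funPT (repr q)).
  - by do 2 apply: measurableT_comp => //.
  - by apply: filterS qf => x /= /(_ I) ->.
exists (HB.pack_for (LspaceType mu (@lexx _ _ 1%E)) q (isFinLebesgue.Build _ _ _ mu 1%E (lexx _) q finq)).
exact: qf.
Qed.
End L1space_theory.

Lemma infinite_set_nat (A : set nat) :
  (forall N, exists2 n, (N <= n)%N & A n) -> infinite_set A.
Proof.
move=> unb /finite_seqP[r rA]; have [n] := unb (\max_(i <- r) i).+1.
rewrite rA /= => rn nr; move: rn; rewrite ltnNge => /negP; apply.
exact: leq_bigmax_seq.
Qed.

(** * Almost everywhere oscillation *)

Section ae_oscillation.
Context (R : realType).
Local Notation mu := (@lebesgue01 R).
Implicit Types (f g : R -> R).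

Lemma dyadic_condexp_ae_eq n f g :
    measurable_fun setT f -> measurable_fun setT g -> f = g %[ae mu] ->
  dyadic_condexp n f = dyadic_condexp n g.
Proof.
move=> mf mg fg; apply/funext => x; apply: eq_bigr => j _; congr (_ / _ * _).
rewrite /Rintegral (@ae_eq_integral _ (measurableTypeR R) R mu _ (EFin \o g))//.
- exact: measurable_dyadic_itv.
- by apply/measurable_EFinP; exact: measurable_funTS.
- by apply/measurable_EFinP; exact: measurable_funTS.
- by apply: (ae_eq_subset (@subsetT _ _)); exact: ae_eq_comp fg.
Qed.

(** The averages depend only on the class of the function, so oscillation at [x] can differ only
    where $f(x) \ne g(x)$. *)
Lemma ae_oscillating_ae_eq f g :
    measurable_fun setT f -> measurable_fun setT g -> f = g %[ae mu] ->
    mu.-negligible [set x | ~ dyadic_oscillating g x] ->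
  mu.-negligible [set x | ~ dyadic_oscillating f x].
Proof.
move=> mf mg fg ng; apply: negligibleS (negligibleU ng fg) => x /= nf.
apply: contrapT => /not_orP[/contrapT og /contrapT /(_ I) fgx]; apply: nf => N.
have [[n Nn up] [m Nm dn]] := og N.
by split; [exists n|exists m]; rewrite // (dyadic_condexp_ae_eq _ mf mg fg) fgx.
Qed.

Lemma ae_step_affine_oscillating m c (t : R) : 0 < t ->
  mu.-negligible [set x | ~ dyadic_oscillating (fun y => dyadic_step m c y + t * y) x].
Proof.
move=> t0; have countQ : countable (@rational R) by apply: sub_countable (card_image_le _ _) _; exact: countableP.
have negQ : mu.-negligible (@rational R).
  exists (@rational R); split => //; first exact: countable_measurable.
  apply: countable_lebesgue_measure0; apply: sub_countable countQ.
  by apply: subset_card_le; exact: subIsetl.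
have neg01 : mu.-negligible (~` `[0, 1]).
  exists (~` `[0, 1]); split => //; first exact: measurableC.
  by rewrite /lebesgue01/= /mrestr setICl measure0.
apply: negligibleS (negligibleU negQ neg01) => x /= nosc.
apply: contrapT => /not_orP[xQ /contrapT]; rewrite in_itv/= => /andP[x0 x1].
apply: nosc; apply: step_affine_oscillates => //.
(* The endpoint $1$, outside all atoms, is already excluded as a rational. *)
rewrite x0 lt_neqAle x1 andbT; apply: contra_notN xQ => /eqP ->.
by exists 1; rewrite ?rmorph1.
Qed.

End ae_oscillation.

(** Write $g = f - (f - g)$, a difference of integrable functions. *)
Lemma integrable_L1_near d (T : measurableType d) (R : realType)
    (mu : {measure set T -> \bar R}) (f g : T -> R) :
    mu.-integrable setT (EFin \o f) -> measurable_fun setT g ->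
    (\int[mu]_x `|f x - g x|%:E < +oo)%E ->
  mu.-integrable setT (EFin \o g).
Proof.
move=> intf mg fgoo.
have mf : measurable_fun setT f by case/integrableP : intf => /measurable_EFinP.
have intfg : mu.-integrable setT (EFin \o (f \- g)).
  apply/integrableP; split; last exact: fgoo.
  by apply/measurable_EFinP; exact: measurable_funB.
have := integrableB measurableT intf intfg.
by apply: eq_integrable => // x _ /=; rewrite -EFinB opprB addrC subrK.
Qed.

(** * The dense $G_\delta$ of oscillating functions *)

Theorem theorem3p13 (R : realType) :
  exists O : set (L1space (@lebesgue01 R)),
    [/\ Gdelta O, dense O &
      forall G : L1space (@lebesgue01 R), O G ->
        {ae @lebesgue_measure R, forall x : R, x \in `[0%R, 1%R] ->
          infinite_set [set n : nat | (1 <= n)%N /\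
                                      dyadic_condexp n G x > G x] /\
          infinite_set [set n : nat | (1 <= n)%N /\
                                      dyadic_condexp n G x < G x]}].
Proof.
have norm1 : `|1| = 1 :> R by rewrite normr1.
have normN1 : `|-1| = 1 :> R by rewrite normrN1.
exists (\bigcap_k ([set G : L1space (@lebesgue01 R) | escapes 1 k G] `&`
                   [set G : L1space (@lebesgue01 R) | escapes (-1) k G])).
split.
- have open_escapes (s : R) k : `|s| = 1 ->
      open [set G : L1space (@lebesgue01 R) | escapes s k G].
    move=> s1; rewrite openE => G /= escG; rewrite /interior -nbhs_ballE /=.
    have s1' : `|s| <= 1 by rewrite s1.
    have [e e0 He] := escapes_open s1' (integrable_L1space G) escG.
    by exists e => // H /ball_L1spaceE; apply: He; exact: integrable_L1space.
  by eexists; [|reflexivity] => k; apply: openI; exact: open_escapes.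
(* Each ball inside [V] contains the class of a step function plus a linear term, which oscillates
   almost everywhere and so lies in all the open sets at once. *)
- move=> V [G0 VG0] oV.
  have /nbhs_ballP[e /= e0 eV] : nbhs G0 V by exact: open_nbhs_nbhs.
  have [m [c [t [t0 hG]]]] := step_affine_dense (integrable_L1space G0) e0.
  have mh := measurable_step_affine m c t.
  have inth := integrable_L1_near (integrable_L1space G0) mh (lt_trans hG (ltry _)).
  have [G Gh] := exists_L1space inth.
  exists G; split.
    apply: eV; apply/ball_L1spaceE; apply: le_lt_trans hG.
    rewrite le_eqVlt; apply/orP; left; apply/eqP; apply: ge0_ae_eq_integral => //.
    - do 2 apply: measurableT_comp => //.
      by apply: measurable_funB; exact: measurable_L1space.
    - do 2 apply: measurableT_comp => //.
      by apply: measurable_funB => //; exact: measurable_L1space.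
    - by apply: filterS Gh => x /= /(_ I) ->.
  have mG := measurable_L1space G.
  have osc := ae_oscillating_ae_eq mG mh Gh (ae_step_affine_oscillating m c t0).
  by move=> k _; split; exact: ae_oscillating_escapes.
- move=> G OG; have mG := measurable_L1space G.
  have up : (@lebesgue01 R).-negligible [set x | exists N, forall n, (N <= n)%N ->
      1 * (dyadic_condexp n G x - G x) <= 0].
    by apply: escapes_ae => // k; case: (OG k).
  have dn : (@lebesgue01 R).-negligible [set x | exists N, forall n, (N <= n)%N ->
      -1 * (dyadic_condexp n G x - G x) <= 0].
    by apply: escapes_ae => // k; case: (OG k).
  have [A [mA A0 AP]] := negligibleU up dn.
  (* [A] is null for the restricted measure only; intersecting with $[0,1]$ gives a Lebesgue null
     set. *)
  exists (A `&` `[0, 1]); split => //; first exact: measurableI.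
  move=> x /= /not_implyP[x01 nosc]; split => //; apply: AP.
  apply: contrapT => /not_orP[/= xup xdn]; apply: nosc; split; apply: infinite_set_nat => N.
  (* Taking [maxn 1 N] secures the requirement $n \ge 1$. *)
  + have /existsNP[n /not_implyP[Nn /negP]] := (@forallNP _ _).2 xup (maxn 1 N).
    rewrite -ltNge mul1r subr_gt0 => lt_n; move: Nn; rewrite geq_max => /andP[n1 Nn].
    by exists n.
  + have /existsNP[n /not_implyP[Nn /negP]] := (@forallNP _ _).2 xdn (maxn 1 N).
    rewrite -ltNge mulN1r oppr_gt0 subr_lt0 => lt_n.
    by move: Nn; rewrite geq_max => /andP[n1 Nn]; exists n.
Qed.
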